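(* Let $P\subseteq\mathbb{R}^n$ be a full-dimensional ordinary polyhedron, with its unique irredundant representation as an intersection of finitely many closed halfspaces. Then $P$ is tropically convex if and only if each of these defining halfspaces is tropically convex.
   Context: Tropical operations: $x\oplus y=\min(x,y)$ and $x\odot y=x+y$. For $c\in\mathbb{R}$ and $x\in\mathbb{R}^n$, $c\odot x=(c+x_1,\dots,c+x_n)$, and $\oplus$ of vectors is the coordinatewise minimum. A set $U\subseteq\mathbb{R}^n$ is tropically convex if $(c\odot x)\oplus(d\odot y)\in U$ for all $x,y\in U$ and all $c,d\in\mathbb{R}$ with $\min(c,d)=0$. *)

(* Defs.v *)
From mathcomp Require Import all_boot all_order all_algebra.
From mathcomp Require Import boolp classical_sets functions cardinality reals.

Set Implicit Arguments.
Unset Strict Implicit.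
Unset Printing Implicit Defensive.

Import Order.TTheory GRing.Theory Num.Theory.
Local Open Scope classical_set_scope.
Local Open Scope ring_scope.

Section Defs.
Variables (R : realType) (n : nat).
Implicit Types (x y a : 'rV[R]_n) (c d b : R).
Implicit Types (P U H : set 'rV[R]_n) (HH : set (set 'rV[R]_n)).

Definition trop_add x y : 'rV[R]_n := \row_i Num.min (x 0 i) (y 0 i).

Definition trop_scale c x : 'rV[R]_n := \row_i (c + x 0 i).

Definition tropically_convex U : Prop :=
  forall x y, U x -> U y ->
  forall c d, Num.min c d = 0 ->
  U (trop_add (trop_scale c x) (trop_scale d y)).

Definition halfspace a b : set 'rV[R]_n :=
  [set x | \sum_(i < n) a 0 i * x 0 i <= b].

Definition closed_halfspace H : Prop :=
  exists a b, a != 0 /\ H = halfspace a b.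

Definition halfspace_rep P HH : Prop :=
  [/\ finite_set HH,
      (forall H, HH H -> closed_halfspace H)
    & P = \bigcap_(H in HH) H].

Definition polyhedron P : Prop := exists HH, halfspace_rep P HH.

Definition irredundant_rep P HH : Prop :=
  halfspace_rep P HH /\
  (forall H, HH H -> \bigcap_(K in HH `\ H) K <> P).

Definition affine_hull P : set 'rV[R]_n :=
  [set z | exists (k : nat) (t : 'I_k -> R) (v : 'I_k -> 'rV[R]_n),
    [/\ forall i, P (v i), \sum_(i < k) t i = 1
      & z = \sum_(i < k) t i *: v i]].

(* dim P = n, the dimension of P being that of its affine hull. *)
Definition full_dimensional P : Prop := affine_hull P = setT.

End Defs.

(* Main.v *)
Require Import Defs.
From HB Require Import structures.
From mathcomp Require Import all_boot all_order all_algebra.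
From mathcomp Require Import boolp classical_sets cardinality reals.
From mathcomp Require Import interval_inference topology normedtype convex.
From mathcomp Require Import ring lra.

(** If [H] is a defining halfspace of [P], irredundancy and full-dimensionality
    give a point [w] on the boundary of [H] in the interior of the intersection
    [Q] of the other defining halfspaces.  A homothety centred at [w] of small
    ratio [t > 0] preserves [H], moves any given point into [Q], and turns the
    tropical combination [min (c + x, d + y)] into [min (t c + x', t d + y')],
    where [x'], [y'] are the images of [x], [y].  Hence tropical convexity of
    [P = H `&` Q] passes to [H]. *)

Set Implicit Arguments.
Unset Strict Implicit.
Unset Printing Implicit Defensive.

Import Order.TTheory GRing.Theory Num.Theory.
Import numFieldNormedType.Exports.
Local Open Scope classical_set_scope.
Local Open Scope ring_scope.

Section Homothety.
Variables (R : nzRingType) (E : lmodType R).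
Implicit Types (p q w x v : E) (t : R).

Definition homothety w t x : E := (1 - t) *: w + t *: x.

Lemma homothetyE w t x : homothety w t x = w + t *: (x - w).
Proof. by rewrite /homothety scalerBl scale1r scalerBr addrAC -addrA. Qed.

Lemma homothety_onem w t x : homothety w (1 - t) x = homothety x t w.
Proof. by rewrite /homothety subKr addrC. Qed.

Lemma homothety_addl p v t q :
  homothety (p + v) t q = homothety p t q + (1 - t) *: v.
Proof. by rewrite /homothety scalerDr addrAC. Qed.

End Homothety.

Section AlgebraicInterior.
Variables (R : realFieldType) (E : lmodType R).
Implicit Types (p q w x : E) (t : R) (A B K P : set E).

Lemma convex_setP K : convex_set K <->
  forall p q t, K p -> K q -> 0 <= t <= 1 -> K (homothety p t q).
Proof.
split=> [convK p q t Kp Kq /andP[t0 t1]|homK p q t].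
  have := convK q p (Itv01 t0 t1); rewrite !inE => /(_ Kq Kp).
  by rewrite /homothety addrC.
rewrite !inE => Kp Kq; have := homK q p t%:num Kq Kp.
by rewrite /homothety addrC; apply; rewrite ge0 le1.
Qed.

Lemma convex_set_bigcap (I : Type) (D : set I) (F : I -> set E) :
  (forall i, D i -> convex_set (F i)) -> convex_set (\bigcap_(i in D) F i).
Proof.
move=> convF; apply/convex_setP => p q t Fp Fq t01 i Di.
by have /convex_setP := convF i Di; apply=> //; [exact: Fp|exact: Fq].
Qed.

Definition core K : set E :=
  [set w | forall x, \forall t \near 0^'+, K (homothety w t x)].

Lemma coreT : core setT = setT.
Proof. by apply/seteqP; split=> // w _ x; exact: filterT. Qed.

Lemma coreI A B : core (A `&` B) = core A `&` core B.
Proof.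
apply/seteqP; split=> [w wAB|w [wA wB] x].
  by split=> x; apply: filterS (wAB x) => t [].
by apply: filterS2 (wA x) (wB x) => t At Bt; split.
Qed.

Lemma core_homothety K p q t : convex_set K ->
  core K p -> K q -> 0 <= t < 1 -> core K (homothety p t q).
Proof.
move=> /convex_setP convK pK Kq /andP[t0 t1] x; set w := homothety p t q.
have onem_neq0 : 1 - t != 0 by rewrite subr_eq0 gt_eqF.
(* The preimage of [x] under the affine map [homothety^~ t q : p |-> w]. *)
pose x' := p + (1 - t)^-1 *: (x - w).
have homothety_w s : homothety w s x = homothety (homothety p s x') t q.
  rewrite [in RHS](homothetyE p) /x' addrAC subrr add0r homothety_addl.
  by rewrite homothetyE [in RHS]scalerA mulrC -scalerA scalerKV.
apply: filterS (pK x') => s Ks.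
by rewrite homothety_w; apply: convK; rewrite // t0 ltW.
Qed.

Lemma core_meetI P A B : convex_set P -> convex_set A -> convex_set B ->
  P `<=` A -> P `<=` B -> P `&` core A !=set0 -> P `&` core B !=set0 ->
  P `&` core (A `&` B) !=set0.
Proof.
move=> /convex_setP convP convA convB PA PB [p [Pp Ap]] [q [Pq Bq]].
exists (homothety p 2^-1 q); split; first by apply: convP => //; lra.
rewrite coreI; split; first by apply: core_homothety (PA _ Pq) _ => //; lra.
have -> : 2^-1 = 1 - 2^-1 :> R by field.
by rewrite homothety_onem; apply: core_homothety (PB _ Pp) _ => //; lra.
Qed.

Lemma core_meet_bigcap P (KK : set (set E)) :
  finite_set KK -> convex_set P -> P !=set0 ->
  (forall K, KK K -> [/\ convex_set K, P `<=` K & P `&` core K !=set0]) ->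
  P `&` core (\bigcap_(K in KK) K) !=set0.
Proof.
move=> /finite_seqP[s ->] convP P0.
elim: s => [_|K s IHs sP]; first by rewrite bigcap_seq big_nil coreT setIT.
have [convK PK PcK] := sP K (mem_head K s).
have {}sP L : L \in s -> _ := fun Ls => sP L (mem_behead (s := K :: s) Ls).
rewrite bigcap_seq big_cons -bigcap_seq.
apply: core_meetI => //; last exact: IHs.
- by apply: convex_set_bigcap => L /sP[].
- by apply: sub_bigcap => L /sP[].
Qed.

End AlgebraicInterior.

Section DotProduct.
Variables (R : comNzRingType) (n : nat).
Implicit Types (a w x : 'rV[R]_n) (t : R).

Definition dot a x : R := \sum_(i < n) a 0 i * x 0 i.

Fact dot_is_scalar a : scalar (dot a).
Proof.
move=> t x y; rewrite /dot mulr_sumr -big_split; apply: eq_bigr => i _.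
by rewrite !mxE mulrDr mulrCA.
Qed.

HB.instance Definition _ a :=
  GRing.isLinear.Build R 'rV[R]_n R *%R (dot a) (dot_is_scalar a).

Lemma dot_homothety a w t x :
  dot a (homothety w t x) = (1 - t) * dot a w + t * dot a x.
Proof. by rewrite linearD !linearZ. Qed.

End DotProduct.

Lemma dot_gt0 (R : realDomainType) n (a : 'rV[R]_n) : a != 0 -> 0 < dot a a.
Proof.
move=> a0; have sq_ge0 i : true -> 0 <= a 0 i * a 0 i by rewrite -expr2 sqr_ge0.
rewrite lt_neqAle sumr_ge0 // andbT eq_sym; apply: contra_neq a0 => aa0.
apply/rowP => i; rewrite mxE; apply/eqP; rewrite -[_ == 0]orbb -mulf_eq0.
by rewrite (psumr_eq0P sq_ge0 aa0).
Qed.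

Section Halfspaces.
Variables (R : realType) (n : nat).
Implicit Types (a x : 'rV[R]_n) (b : R).
Implicit Types (P Q H : set 'rV[R]_n) (HH : set (set 'rV[R]_n)).

Lemma halfspaceE a b : halfspace a b = [set x | dot a x <= b].
Proof. by []. Qed.

Lemma convex_halfspace a b : convex_set (halfspace a b).
Proof.
apply/convex_setP => p q t; rewrite halfspaceE /= => pb qb /andP[t0 t1].
by rewrite dot_homothety; nra.
Qed.

Lemma convex_closed_halfspace H : closed_halfspace H -> convex_set H.
Proof. by case=> a [b [_ ->]]; exact: convex_halfspace. Qed.

Lemma core_halfspace a b : a != 0 ->
  core (halfspace a b) = [set x | dot a x < b].
Proof.
move=> /dot_gt0 aa; rewrite halfspaceE; apply/seteqP; split=> [w wb|w wb x] /=.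
  have [t /= [t0]] := filter_ex (filterI (nbhs_right_gt 0) (wb (w + a))).
  by rewrite dot_homothety linearD /=; nra.
pose d := 1 + `|dot a x - dot a w|.
have d0 : 0 < d by rewrite ltr_pwDl.
near=> t; have t0 : 0 < t by [].
have : t < (b - dot a w) / d.
  by near: t; apply: nbhs_right_lt; rewrite divr_gt0 // subr_gt0.
rewrite ltr_pdivlMr // dot_homothety.
by have := ler_norm (dot a x - dot a w); rewrite /d; nra.
Unshelve. all: by end_near. Qed.

Lemma affine_hull_sub_hyperplane P a b : (forall v, P v -> dot a v = b) ->
  affine_hull P `<=` [set z | dot a z = b].
Proof.
move=> Pb _ [k [t [v [Pv t1 ->]]]] /=; rewrite linear_sum.
under eq_bigr => i _ do rewrite linearZ /= Pb //.
by rewrite -mulr_suml t1 mul1r.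
Qed.

Lemma full_dimensional_nonempty P : full_dimensional P -> P !=set0.
Proof.
move=> fP; have : affine_hull P 0 by rewrite fP.
case=> -[|k] [t [v [Pv t1 _]]]; last by exists (v ord0).
by move/eqP: t1; rewrite big_ord0 eq_sym oner_eq0.
Qed.

Lemma full_dimensional_meet_core_halfspace P a b : full_dimensional P ->
  a != 0 -> P `<=` halfspace a b -> P `&` core (halfspace a b) !=set0.
Proof.
move=> fP a0 PH; rewrite core_halfspace //; apply: contrapT => noP.
have P_eq_b v : P v -> dot a v = b.
  move=> Pv; apply: le_anti; rewrite PH //= leNgt; apply/negP => vb.
  by apply: noP; exists v.
have eq_b z : dot a z = b.
  by apply: (affine_hull_sub_hyperplane P_eq_b); rewrite fP.
by have := dot_gt0 a0; rewrite eq_b -(eq_b 0) linear0 ltxx.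
Qed.

Lemma full_dimensional_polyhedron_core P HH : full_dimensional P ->
  halfspace_rep P HH -> core P !=set0.
Proof.
move=> fP [finHH closedHH PE].
have convHH K : HH K -> convex_set K.
  by move/closedHH; exact: convex_closed_halfspace.
have PHH K : HH K -> P `<=` K by move=> HK; rewrite PE; exact: bigcap_inf.
suff [p [_ cp]] : P `&` core (\bigcap_(K in HH) K) !=set0.
  by exists p; rewrite PE.
apply: core_meet_bigcap => //; first by rewrite PE; exact: convex_set_bigcap.
  exact: full_dimensional_nonempty.
move=> K HK; split; [exact: convHH|exact: PHH|].
have [a [b [a0 KE]]] := closedHH K HK.
rewrite KE; apply: full_dimensional_meet_core_halfspace => //.
by rewrite -KE; exact: PHH.
Qed.

Lemma exists_facet_point Q a b : a != 0 -> convex_set Q ->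
  core (halfspace a b `&` Q) !=set0 -> ~ (Q `<=` halfspace a b) ->
  exists2 w, dot a w = b & core Q w.
Proof.
move=> a0 convQ [p]; rewrite coreI core_halfspace // => -[/= pb cQp].
move=> /nonsubset[q [Qq qNH]].
have qb : b < dot a q by rewrite ltNge; apply/negP.
have pq : 0 < dot a q - dot a p by lra.
pose t := (b - dot a p) / (dot a q - dot a p).
have tE : t * (dot a q - dot a p) = b - dot a p by rewrite divfK // gt_eqF.
exists (homothety p t q); first by rewrite dot_homothety; lra.
apply: core_homothety => //.
by rewrite divr_ge0 ?ltr_pdivrMr //= ?mul1r; lra.
Qed.

End Halfspaces.

Section TropicalConvexity.
Variables (R : realType) (n : nat).
Implicit Types (a w x y : 'rV[R]_n) (b c t : R) (Q : set 'rV[R]_n).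

Lemma homothety_trop_add w t x y : 0 <= t ->
  homothety w t (trop_add x y) =
  trop_add (homothety w t x) (homothety w t y).
Proof. by move=> t0; apply/rowP => i; rewrite !mxE minr_pMr // addr_minr. Qed.

Lemma homothety_trop_scale w t c x :
  homothety w t (trop_scale c x) = trop_scale (t * c) (homothety w t x).
Proof. by apply/rowP => i; rewrite !mxE; ring. Qed.

Lemma tropically_convex_bigcap (HH : set (set 'rV[R]_n)) :
  (forall H, HH H -> tropically_convex H) ->
  tropically_convex (\bigcap_(H in HH) H).
Proof.
move=> tropHH x y HHx HHy c d cd H HHH.
by apply: tropHH => //; [exact: HHx|exact: HHy].
Qed.

Lemma tropically_convex_halfspace_facet Q a b w : dot a w = b -> core Q w ->
  tropically_convex (halfspace a b `&` Q) -> tropically_convex (halfspace a b).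
Proof.
move=> wb cQw tropHQ x y Hx Hy c d cd.
have [t /= [t0 [Qx Qy]]] :=
  filter_ex (filterI (nbhs_right_gt 0) (filterI (cQw x) (cQw y))).
have homothety_halfspace z :
    halfspace a b (homothety w t z) <-> halfspace a b z.
  by rewrite halfspaceE /= dot_homothety wb; split; nra.
have tcd : Num.min (t * c) (t * d) = 0 by rewrite -minr_pMr ?ltW // cd mulr0.
apply/homothety_halfspace.
rewrite homothety_trop_add ?ltW // !homothety_trop_scale.
by apply: (tropHQ _ _ _ _ _ _ tcd).1; split=> //; apply/homothety_halfspace.
Qed.

End TropicalConvexity.

Theorem theorem2p6 (R : realType) (n : nat) (P : set 'rV[R]_n)
    (HH : set (set 'rV[R]_n)) :
  polyhedron P -> full_dimensional P -> irredundant_rep P HH ->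
  (tropically_convex P <-> forall H, HH H -> tropically_convex H).
Proof.
move=> _ fP [rep irr]; have [_ closedHH PE] := rep.
split=> [tropP H HHH|]; last by rewrite PE; exact: tropically_convex_bigcap.
have [a [b [a0 HE]]] := closedHH H HHH.
pose Q := \bigcap_(K in HH `\ H) K.
have PHQ : P = halfspace a b `&` Q by rewrite -HE PE (bigcap_setD1 H).
have convQ : convex_set Q.
  by apply: convex_set_bigcap => K [/closedHH /convex_closed_halfspace].
have QH : ~ (Q `<=` halfspace a b).
  by move=> /setIidr QH; apply: (irr H HHH); rewrite PHQ QH.
have [|w wb cQw] := exists_facet_point a0 convQ _ QH.
  by rewrite -PHQ; exact: full_dimensional_polyhedron_core rep.
by rewrite HE; apply: (tropically_convex_halfspace_facet wb cQw); rewrite -PHQ.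
Qed.
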